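(* Let $(A,\sigma)$ be a real Hermitian algebra and $G=\mathrm{O}_{(1,1)}(A,\sigma)$. Let $F_{\mathfrak{C}_G,\mathfrak{P}_G^\pm}\colon\mathfrak{C}_G\to\mathfrak{P}_G^\pm$ be the map sending an operator $J$ to its eigenline $l_J^\pm$. Let $J\in\mathfrak{C}_G$, $L\in T_J\mathfrak{C}_G$, and let $x\in l_J^\pm$ be a generator of $l_J^\pm$. Then $$d_JF_{\mathfrak{C}_G,\mathfrak{P}_G^\pm}(L)=\left[x,\pm\tfrac12L(x)+l_J^\pm\right]=\pm\tfrac12[L]\in T_{l_J^\pm}\mathfrak{P}_G^\pm,$$ where $[L]\colon l_J^\pm\to A^2/l_J^\pm$ is the composition of $L|_{l_J^\pm}\colon l_J^\pm\to A^2$ with the natural projection $A^2\to A^2/l_J^\pm$.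
   Context: $A$ is a unital associative, possibly noncommutative, finite-dimensional semisimple $\mathbb{R}$-algebra and $\sigma\colon A\to A$ is an anti-involution: $\mathbb{R}$-linear, $\sigma(ab)=\sigma(b)\sigma(a)$, $\sigma^2=\mathrm{Id}$. Put $A^\sigma=\{a\in A\mid\sigma(a)=a\}$, $A^\times$ the group of invertible elements, $\mathrm{O}(A,\sigma)=\{a\in A^\times\mid \sigma(a)=a^{-1}\}$, $A^\sigma_+=\{a^2\mid a\in A^\sigma\cap A^\times\}$, $A^\sigma_-=-A^\sigma_+$, $A^\sigma_{\ge 0}=\{a^2\mid a\in A^\sigma\}$. The pair $(A,\sigma)$ is Hermitian if for $x,y\in A^\sigma$, $x^2+y^2=0$ implies $x=y=0$; as standing properties of Hermitian algebras, $A^\sigma_+$ and $A^\sigma_{\ge0}$ are proper convex cones in $A^\sigma$, $\mathrm{O}(A,\sigma)$ is compact, and $x\mapsto ax\sigma(a)$ preserves $A^\sigma_+$ and $A^\sigma_{\geq 0}$ for every $a\in A^\times$. $A^2$ is the right $A$-module of columns; $x\in A^2$ is regular if there is $y\in A^2$ such that $(a,b)\mapsto xa+yb$ is an isomorphism $A^2\to A^2$ of right $A$-modules; an $A$-line is a submodule $xA$ with $x$ regular, and $\mathbb{P}(A^2)$ is the space of $A$-lines. Its tangent space at $l$ is $\mathrm{Hom}_A(l,A^2/l)$; for a generator $x$ of $l$ and $w\in A^2/l$, $[x,w]$ denotes the $A$-linear map $l\to A^2/l$, $xa\mapsto wa$ (it is the velocity of $x(t)A$ if $x(0)=x$ and $\dot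 x(0)+l=w$). For $x,y\in A^2$ let $h(x,y)=\sigma(x)^t\begin{pmatrix}0&1\\1&0\end{pmatrix}y$; $\mathrm{O}_{(1,1)}(A,\sigma)$ is the group of $A$-linear automorphisms of $A^2$ preserving $h$. A form $b\colon A^2\times A^2\to A$ that is biadditive with $b(xr_1,yr_2)=\sigma(r_1)b(x,y)r_2$ is a $\sigma$-inner product if $b(x,y)=\sigma(b(y,x))$ for all $x,y$, and for all regular $x$, $b(x,x)\in A^\sigma_{\geq0}$, with $b(x,x)=0$ if and only if $x=0$. An $A$-linear $J\colon A^2\to A^2$ is an indefinite involutive operator if $J^2=\mathrm{Id}$ and there are two $A$-lines $l_J^+,l_J^-$ with $J|_{l_J^+}=\mathrm{Id}$, $J|_{l_J^-}=-\mathrm{Id}$. $\mathfrak{C}_G$ is the set of indefinite involutive operators $J$ such that $h_J(x,y):=h(J(x),y)$ is a $\sigma$-inner product; it is a smooth manifold (a homogeneous space of $G$ under conjugation), and tangent vectors are regarded as $A$-linear maps $L\colon A^2\to A^2$. $\mathfrak{P}_G^\pm=\{xA\mid x\in A^2\text{ regular},\ h(x,x)\in A^\sigma_\pm\}$, an open subset of $\mathbb{P}(A^2)$. *)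

(* Defs.v *)
From HB Require Import structures.
From mathcomp Require Import all_boot all_order all_algebra all_field.
From mathcomp Require Import all_classical all_reals all_analysis.
Set Implicit Arguments.
Unset Strict Implicit.
Unset Printing Implicit Defensive.
Import Order.TTheory GRing.Theory Num.Theory.
Import numFieldNormedType.Exports.
Local Open Scope classical_set_scope.
Local Open Scope ring_scope.

(* Semisimplicity of A as a right A-module: right ideals are complemented. *)
Definition right_ideal (R : fieldType) (A : falgType R) (U : {vspace A}) :=
  forall u a : A, u \in U -> u * a \in U.

Definition semisimple_algebra (R : fieldType) (A : falgType R) :=
  forall U : {vspace A}, right_ideal U ->
  exists V : {vspace A}, [/\ right_ideal V, (U + V = fullv)%VS & (U :&: V = 0)%VS].

(* The finite-dimensional real space V carries its canonical topology, in which
   a curve is differentiable iff its composites with linear forms are. *)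
Definition has_curve_derivative (R : realType) (V : vectType R)
    (c : R -> V) (t : R) (v : V) :=
  forall f : {scalar V}, is_derive t (1 : R) (fun s => f (c s) : R) (f v).

Section HermitianProjectiveLine.
Context {R : realType} {A : falgType R}.
Implicit Types (x y u v : A * A) (l M : set (A * A)) (J L : 'End((A * A)%type)).

Section Involution.
Variable sigma : {linear A -> A}.

Definition anti_involution :=
  (forall a b, sigma (a * b) = sigma b * sigma a) /\
  (forall a, sigma (sigma a) = a).

Definition sym : set A := [set a | sigma a = a].

Definition is_hermitian :=
  forall a b, sym a -> sym b -> a ^+ 2 + b ^+ 2 = 0 -> a = 0 /\ b = 0.

(* In this file a boolean s stands for the sign (-1) ^+ s, so that s = false
   is + and s = true is -. *)
Definition sym_sign (s : bool) : set A :=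
  [set (-1) ^+ s * c ^+ 2 | c in sym `&` [set c | c \is a GRing.unit]].

Definition sym_ge0 : set A := [set c ^+ 2 | c in sym].

End Involution.

(* The column with entries x.1 and x.2 is encoded as the pair x : A * A, which
   is a vectType over R; A acts on it on the right. *)
Definition act x (a : A) : A * A := (x.1 * a, x.2 * a).

Definition regular x :=
  exists y, bijective (fun ab : A * A => act x ab.1 + act y ab.2).

Definition line x : set (A * A) := range (act x).

Definition is_line l := exists2 x, regular x & l = line x.

Definition generator x l := l = line x.

Definition A_linear J := forall x (a : A), J (act x a) = act (J x) a.

(* Elements of A^2 / l are represented by cosets, and a map l -> A^2 / l by a
   function phi : A * A -> set (A * A) of which only the values on l matter. *)
Definition coset l v : set (A * A) := [set v + u | u in l].

Definition coset_act l (w : set (A * A)) (a : A) : set (A * A) :=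
  \bigcup_(v in w) coset l (act v a).

Definition coset_scale l (r : R) (w : set (A * A)) : set (A * A) :=
  \bigcup_(v in w) coset l (r *: v).

Definition eq_hom l (phi psi : A * A -> set (A * A)) :=
  forall u, l u -> phi u = psi u.

(* Hom_A(l, A^2 / l), the tangent space of the projective line at l. *)
Definition is_hom l (phi : A * A -> set (A * A)) :=
  (forall u, l u -> exists v, phi u = coset l v) /\
  (forall u u' v v' (a : A), l u -> l u' ->
     phi u = coset l v -> phi u' = coset l v' ->
     phi (u + act u' a) = coset l (v + act v' a)).

(* [x, w] : x a |-> w a; for regular x the union has one term when u is in x A. *)
Definition bracket l x (w : set (A * A)) : A * A -> set (A * A) :=
  fun u => \bigcup_(a in [set a | act x a = u]) coset_act l w a.

(* [L] : restriction of L to l followed by the projection to A^2 / l. *)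
Definition proj_restr l L : A * A -> set (A * A) := fun u => coset l (L u).

Definition scale_hom l (r : R) (phi : A * A -> set (A * A)) :
    A * A -> set (A * A) :=
  fun u => coset_scale l r (phi u).

(* The curve c of lines in the open set M has velocity phi at time 0: near 0 it
   is t |-> x(t) A with x(t) regular, x differentiable at 0, and
   phi = [x(0), x'(0) + c(0)]. On c(0), phi does not depend on the lift x. *)
Definition has_velocity (M : set (set (A * A))) (c : R -> set (A * A))
    (phi : A * A -> set (A * A)) :=
  exists (x : R -> A * A) (v : A * A),
    [/\ \forall t \near 0, [/\ M (c t), regular (x t) & c t = line (x t)],
        has_curve_derivative x 0 v
      & eq_hom (c 0) phi (bracket (c 0) (x 0) (coset (c 0) v))].

(* The curve c of operators in the submanifold C of End_A(A^2) passes through J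
   at time 0 with velocity L. *)
Definition curve_through (C : set 'End((A * A)%type)) (c : R -> 'End((A * A)%type))
    J L :=
  [/\ \forall t \near 0, C (c t), c 0 = J & has_curve_derivative c 0 L].

Definition tangent (C : set 'End((A * A)%type)) J : set 'End((A * A)%type) :=
  [set L | exists c, curve_through C c J L].

(* phi is the value at L of the differential at J of F : C -> M. Curves are only
   required to be differentiable at 0: in finite dimension, that F sends all of
   them to curves differentiable at 0, with velocity depending linearly on L,
   amounts to (Frechet) differentiability of F at J. *)
Definition is_differential (C : set 'End((A * A)%type)) (M : set (set (A * A)))
    (F : 'End((A * A)%type) -> set (A * A)) J L (phi : A * A -> set (A * A)) :=
  forall c, curve_through C c J L -> has_velocity M (F \o c) phi.

(* L is an A-line on which J is the scalar (-1) ^+ s. *)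
Definition is_eigenline (s : bool) J l :=
  is_line l /\ forall u, l u -> J u = (-1) ^+ s *: u.

Definition indefinite_involutive J :=
  [/\ A_linear J, (J \o J = \1)%VF,
      exists l, is_eigenline false J l & exists l, is_eigenline true J l].

Section Spaces.
Variable sigma : {linear A -> A}.

Definition h x y : A := sigma x.1 * y.2 + sigma x.2 * y.1.

Definition O11 : set 'End((A * A)%type) :=
  [set g | [/\ A_linear g, lker g = 0%VS & forall x y, h (g x) (g y) = h x y]].

Definition sigma_inner_product (b : A * A -> A * A -> A) :=
  [/\ forall x x' y, b (x + x') y = b x y + b x' y,
      forall x y y', b x (y + y') = b x y + b x y',
      forall x y (r1 r2 : A), b (act x r1) (act y r2) = sigma r1 * b x y * r2,
      forall x y, b x y = sigma (b y x)
    & forall x, regular x -> sym_ge0 sigma (b x x) /\ (b x x = 0 <-> x = 0)].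

Definition CG : set 'End((A * A)%type) :=
  [set J | indefinite_involutive J /\ sigma_inner_product (fun x y => h (J x) y)].

Definition PG (s : bool) : set (set (A * A)) :=
  [set l | exists x, [/\ regular x, l = line x & sym_sign sigma s (h x x)]].

End Spaces.

(* The map F sending J to its eigenline; see eigenline_unique. *)
Definition eigenline (s : bool) J : set (A * A) := get (is_eigenline s J).

Lemma act0 x : act x 0 = 0.
Proof. by rewrite /act !mulr0. Qed.

Lemma actD x (a b : A) : act x (a + b) = act x a + act x b.
Proof. by rewrite /act !mulrDr. Qed.

Lemma actB x (a b : A) : act x (a - b) = act x a - act x b.
Proof. by rewrite /act !mulrBr. Qed.

Lemma actZ x (r : R) (a : A) : act x (r *: a) = r *: act x a.
Proof. by rewrite /act -!scalerAr. Qed.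

Lemma regular_act_inj x (a : A) : regular x -> act x a = 0 -> a = 0.
Proof.
move=> [y /bij_inj inj] xa0; have := inj (a, 0) 0.
by rewrite /= !act0 xa0 addr0 => /(_ erefl) [].
Qed.

Lemma signZ_eq0 (s : bool) u : (-1) ^+ s *: u = (-1) ^+ (~~ s) *: u :> A * A ->
  u = 0.
Proof.
have key v : v = - v -> v = 0 :> A * A.
  move=> /eqP; rewrite -subr_eq0 opprK -mulr2n -scaler_nat scaler_eq0.
  by rewrite pnatr_eq0 => /eqP.
case: s; rewrite expr0 expr1 scale1r scaleN1r => E; exact: key.
Qed.

Lemma eigenline_decomp (s : bool) J x y :
  regular x -> is_eigenline s J (line x) ->
  regular y -> is_eigenline (~~ s) J (line y) ->
  forall u, exists a b, u = act x a + act y b.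
Proof.
move=> rx [_ Jx] ry [_ Jy] u.
pose f (ab : A * A) := act x ab.1 + act y ab.2.
have lf : linear f.
  by move=> r p q; rewrite /f /= !actD !actZ scalerDr addrACA.
pose fL := GRing.isLinear.Build R (A * A)%type (A * A)%type *:%R f lf.
pose g : {linear (A * A)%type -> (A * A)%type} := HB.pack f fL.
have kf : lker (linfun g) == 0%VS.
  apply/lker0P => p q; rewrite !lfunE /= /f => E.
  have E' : act x (p.1 - q.1) = act y (q.2 - p.2).
    by apply/eqP; rewrite !actB subr_eq addrAC eq_sym subr_eq addrC eq_sym E addrC.
  have := congr1 J E'; rewrite Jx; last by exists (p.1 - q.1).
  rewrite Jy; last by exists (q.2 - p.2).
  rewrite -E' => /signZ_eq0 x0; rewrite x0 in E'.
  have /eqP := regular_act_inj rx x0; have /eqP := regular_act_inj ry (esym E').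
  by rewrite !subr_eq0; case: p q {E x0 E'} => [? ?] [? ?] /= /eqP -> /eqP ->.
exists ((linfun g)^-1%VF u).1, ((linfun g)^-1%VF u).2.
by have := lker0_lfunVK kf u; rewrite lfunE /= => {1}<-.
Qed.

Lemma eigenline_unique (s : bool) J l l' m :
  is_eigenline s J l -> is_eigenline s J l' -> is_eigenline (~~ s) J m -> l = l'.
Proof.
move: l l'.
suff sub l l' : is_eigenline s J l -> is_eigenline s J l' ->
    is_eigenline (~~ s) J m -> l' `<=` l.
  by move=> l l' el el' em; apply/seteqP; split; apply: sub.
move=> [[x rx ->] Jx] [_ Jl'] [[y ry ->] Jy] u l'u.
have [] := eigenline_decomp rx (conj _ Jx) ry (conj _ Jy) u; [by exists x|by exists y|].
move=> a [b ub]; exists a => //.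
have := Jl' u l'u; rewrite {1}ub linearD /= Jx; last by exists a.
rewrite Jy; last by exists b.
by rewrite ub scalerDr => /addrI /esym /signZ_eq0 ->; rewrite addr0.
Qed.

Lemma CG_eigenline (sigma : {linear A -> A}) (s : bool) J l :
  CG sigma J -> is_eigenline s J l -> eigenline s J = l.
Proof.
move=> [[_ _ [lp ep] [lm em]] _] el.
have [m em'] : exists m, is_eigenline (~~ s) J m.
  by case: (s); [exists lp|exists lm].
apply: (eigenline_unique _ el em').
by apply: (@getPex _ (is_eigenline s J)); exists l.
Qed.

(* G = O_(1,1)(A, sigma) acts on CG by conjugation. *)
Lemma CG_conj (sigma : {linear A -> A}) g J :
  O11 sigma g -> CG sigma J -> CG sigma (g \o J \o g^-1)%VF.
Proof.
move=> [Ag kg hg] [[AJ JJ [lp ep] [lm em]] [b1 b2 b3 b4 b5]].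
have gK : cancel g g^-1%VF by apply: lker0_lfunK; apply/eqP.
have gK' : cancel g^-1%VF g by apply: lker0_lfunVK; apply/eqP.
have Ai : A_linear g^-1%VF by move=> x a; rewrite -{1}(gK' x) -Ag gK.
have hi x y : h sigma x (g^-1%VF y) = h sigma (g x) y by rewrite -hg gK'.
have reg f f' x : A_linear f -> cancel f f' -> cancel f' f -> regular x ->
    regular (f x).
  move=> Af fK fK' [y [k k1 k2]]; exists (f y), (k \o f') => [p|u] /=.
    by rewrite -!Af -linearD fK k1.
  by have /= E := k2 (f' u); rewrite -!Af -linearD E; apply: fK'.
have eig (s : bool) l : is_eigenline s J l ->
    is_eigenline s (g \o J \o g^-1)%VF (g @` l).
  move=> [[x rx ->] Jx]; split.
    exists (g x); first exact: reg gK' rx.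
    apply/seteqP; split => [_ [_ [a _ <-] <-]|_ [a _ <-]].
      by exists a; rewrite // Ag.
    by exists (act x a); [exists a|rewrite Ag].
  by move=> _ [u xu <-]; rewrite !comp_lfunE /= gK Jx // linearZ.
split; first split.
- by move=> x a; rewrite !comp_lfunE /= Ai AJ Ag.
- apply/lfunP => x; rewrite !comp_lfunE /= gK.
  by have /lfunP /(_ (g^-1%VF x)) := JJ; rewrite comp_lfunE /= !id_lfunE => ->; exact: gK'.
- by exists (g @` lp); apply: eig.
- by exists (g @` lm); apply: eig.
have E x y : h sigma ((g \o J \o g^-1)%VF x) y =
    h sigma (J (g^-1%VF x)) (g^-1%VF y).
  by rewrite !comp_lfunE /= hi.
split => [x x' y|x y y'|x y r1 r2|x y|x rx]; rewrite ?E.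
- by rewrite linearD b1.
- by rewrite linearD b2.
- by rewrite !Ai b3.
- exact: b4.
have [p1 p2] := b5 _ (reg _ _ _ Ai gK' gK rx); split => //.
by rewrite p2; split => [/(congr1 g)|->]; rewrite ?gK' linear0.
Qed.

End HermitianProjectiveLine.

(* Main.v *)
(* On the eigenline of c(t) for the sign e, the projection (1 + e c(t)) / 2 is
   the identity, so x(t) = (x + e c(t) x) / 2 lifts the eigenline of the curve c
   as long as it stays a generator; it is affine in c, and its velocity e L x / 2
   at 0 is the claim. *)
Require Import Defs.
From HB Require Import structures.
From mathcomp Require Import all_boot all_order all_algebra all_field.
From mathcomp Require Import all_classical all_reals all_analysis.
Set Implicit Arguments.
Unset Strict Implicit.
Unset Printing Implicit Defensive.
Import Order.TTheory GRing.Theory Num.Theory.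
Import numFieldNormedType.Exports passmx.
Local Open Scope classical_set_scope.
Local Open Scope ring_scope.

(** * Derivatives of curves, tested on linear forms *)

Section CurveDerivative.
Variables (R : realType) (V W : vectType R).
Implicit Types (c : R -> V) (t : R) (v : V).

(** Coordinates in a basis are themselves linear forms. Separation of vectors by forms is what makes
    a velocity unique. *)
Lemma scalar_eq0 v : (forall f : {scalar V}, f v = 0) -> v = 0.
Proof.
move=> f0; rewrite (coord_vbasis (memvf v)).
by rewrite big1 // => i _; rewrite f0 scale0r.
Qed.

(** A form on [W] composed with [g] is again a form on [V], and the constant [k] has derivative
    0. *)
Lemma has_curve_derivative_affine (g : V -> W) (k : W) c t v :
  linear g -> has_curve_derivative c t v ->
  has_curve_derivative (fun s => k + g (c s)) t (g v).
Proof.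
move=> lg dc f.
have lfg : scalar (f \o g) by move=> a p q; rewrite /= lg linearP.
pose fgL := GRing.isLinear.Build R V R *%R (f \o g) lfg.
pose fg : {scalar V} := HB.pack (f \o g) fgL.
have := is_deriveD (is_derive_cst (f k : R) t (1 : R)) (dc fg).
rewrite add0r /=; congr is_derive.
by apply/funext => s /=; rewrite linearD.
Qed.

Lemma has_curve_derivative_linear (g : V -> W) c t v :
  linear g -> has_curve_derivative c t v ->
  has_curve_derivative (g \o c) t (g v).
Proof.
move=> lg /(has_curve_derivative_affine 0 lg).
by congr has_curve_derivative; apply/funext => s; rewrite add0r.
Qed.

Lemma has_curve_derivative_near_unique c c' t v v' :
  (\forall s \near t, c s = c' s) ->
  has_curve_derivative c t v -> has_curve_derivative c' t v' -> v = v'.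
Proof.
move=> cc' dc dc'; apply/eqP; rewrite -subr_eq0; apply/eqP/scalar_eq0 => f.
apply/eqP; rewrite linearB subr_eq0 /=; apply/eqP.
have e : \forall s \near t, (f (c s) : R) = f (c' s).
  by near=> s; congr (f _); near: s.
have := near_eq_derive (1 : R) e.
by rewrite (@derive_val _ _ _ _ _ _ _ (dc f)) (@derive_val _ _ _ _ _ _ _ (dc' f)).
Unshelve. all: by end_near. Qed.

End CurveDerivative.

(** * Invertible endomorphisms and units in finite dimension *)

Lemma lker0_unitmx (K : fieldType) (V : vectType K) (f : 'End(V)) :
  (lker f == 0%VS) = (mxof (vbasis fullv) (vbasis fullv) f \in unitmx).
Proof.
have eb := vbasisP (fullv : {vspace V}).
apply/idP/idP => [kf|uf].
  have := mxof1 (basis_free eb).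
  by rewrite -(lker0_compVf kf) (mxof_comp _ _ eb) => /mulmx1_unit [].
apply/lker0P => p q E; apply: (can_inj (rVofK eb)).
by apply: (can_inj (mulmxK uf)); rewrite -!(rVof_app _ eb) E.
Qed.

(** Matrix entries are linear forms of [c s], hence continuous at [t]; so is the determinant, a
    polynomial in them, and it stays nonzero near [t]. *)
Lemma near_lker0 (R : realType) (V : vectType R) (c : R -> 'End(V)) t L :
  has_curve_derivative c t L -> lker (c t) == 0%VS ->
  \forall s \near t, lker (c s) == 0%VS.
Proof.
set e := vbasis (fullv : {vspace V}) => dc.
have ce i j : (mxof e e (c s) i j : R) @[s --> t] --> (mxof e e (c t) i j : R).
  pose f (X : 'End(V)) : R := mxof e e X i j.
  have lf : scalar f by move=> a X Y; rewrite /f linearP !mxE.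
  pose fL := GRing.isLinear.Build R 'End(V) R *%R f lf.
  pose fs : {scalar 'End(V)} := HB.pack f fL.
  have dfs : derivable (fun s => fs (c s) : R) t 1 by have [] := dc fs.
  by move: dfs => /derivable1_diffP /differentiable_continuous.
have cdet : (\det (mxof e e (c s)) : R) @[s --> t] -->
    (\det (mxof e e (c t)) : R).
  rewrite /determinant; apply: cvg_big => [|p _].
    exact: add_continuous.
  apply: cvgM; first exact: cvg_cst.
  apply: cvg_big => [|i _]; [exact: mul_continuous|exact: ce].
rewrite lker0_unitmx unitmxE unitfE => n0.
near=> s; rewrite lker0_unitmx unitmxE unitfE; near: s.
exact: (cvgr_neq0 _ cdet n0).
Unshelve. all: by end_near. Qed.

(** Left multiplication by [c] is injective, hence bijective by finite dimension. The preimage [d]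
    of 1 is a right inverse, and [c * (d * c - 1) = 0] makes it a left inverse too. *)
Lemma unit_mul_inj (K : fieldType) (A : falgType K) (c : A) :
  (forall a, c * a = 0 -> a = 0) -> c \is a GRing.unit.
Proof.
move=> inj; have kc : lker (amull c) == 0%VS.
  apply/lker0P => p q; rewrite !lfunE /= => E; apply/eqP.
  by rewrite -subr_eq0; apply/eqP/inj; rewrite mulrBr E subrr.
have cd : c * (amull c)^-1%VF 1 = 1.
  by have := lker0_lfunVK kc 1; rewrite [amull c _]lfunE.
apply/unitrP; exists ((amull c)^-1%VF 1); split=> //.
apply/eqP; rewrite -subr_eq0; apply/eqP/inj.
by rewrite mulrBr mulrA cd mul1r mulr1 subrr.
Qed.

(** * Lines, their generators, and homomorphisms to the quotient *)

Section Lines.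
Variables (R : realType) (A : falgType R).
Implicit Types (x y u v w : (A * A)%type) (a b : A) (l : set (A * A)).
Implicit Types (J L g : 'End((A * A)%type)).

Lemma act_act x a b : act (act x a) b = act x (a * b).
Proof. by rewrite /act /= !mulrA. Qed.

Lemma act1 x : act x 1 = x.
Proof. by case: x => p q; rewrite /act /= !mulr1. Qed.

Lemma actDl x y a : act (x + y) a = act x a + act y a.
Proof. by rewrite /act /= !mulrDl. Qed.

Lemma actZl x (r : R) a : act (r *: x) a = r *: act x a.
Proof. by rewrite /act /= -!scalerAl. Qed.

(** Two generators of a line differ by a unit: [z = x a] and [x = z b] force [b * a = 1], and then
    [a] is left cancellable, hence invertible. *)
Lemma regular_generator x l : is_line l -> generator x l -> regular x.
Proof.
move=> [z rz lz] xl.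
have [a _ az] : line x z by rewrite -xl lz; exists 1; rewrite ?act1.
have [b _ bx] : line z x by rewrite -lz xl; exists 1; rewrite ?act1.
have ba1 : b * a = 1.
  apply/eqP; rewrite -subr_eq0; apply/eqP/(regular_act_inj rz).
  by rewrite actB -act_act bx az act1 subrr.
have ua : a \is a GRing.unit.
  by apply: unit_mul_inj => d ad0; rewrite -(mul1r d) -ba1 -mulrA ad0 mulr0.
have ab1 : a * b = 1 by apply: (mulIr ua); rewrite -mulrA ba1 mulr1 mul1r.
(* The complement [y] of [z] serves [x] as well, because [z p + y q = x (a p) + y q]. *)
have [y [k k1 k2]] := rz; exists y, (fun u => (a * (k u).1, (k u).2)).
  move=> [p q] /=; rewrite -bx act_act.
  by have /= -> := k1 (b * p, q); rewrite /= mulrA ab1 mul1r.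
by move=> u /=; rewrite -act_act az; have /= -> := k2 u.
Qed.

Lemma line_act x a : line x (act x a). Proof. by exists a. Qed.

Lemma line_self x : line x x.
Proof. by exists 1; rewrite ?act1. Qed.

Lemma lineD x u v : line x u -> line x v -> line x (u + v).
Proof. by move=> [a _ <-] [b _ <-]; rewrite -actD; exact: line_act. Qed.

Lemma lineZ x (r : R) u : line x u -> line x (r *: u).
Proof. by move=> [a _ <-]; rewrite -actZ; exact: line_act. Qed.

Lemma line_act_closed x u a : line x u -> line x (act u a).
Proof. by move=> [b _ <-]; rewrite act_act; exact: line_act. Qed.

Lemma mem_coset x u v : coset (line x) u v <-> line x (v - u).
Proof.
split=> [[w xw <-]|xvu]; first by rewrite addrAC subrr add0r.
by exists (v - u); rewrite // addrC subrK.
Qed.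

Lemma cosetP x u v : coset (line x) u = coset (line x) v <-> line x (u - v).
Proof.
split=> [E|xuv].
  by apply/mem_coset; rewrite -E; apply/mem_coset; rewrite subrr -(act0 x); exists 0.
apply/seteqP; split=> w /mem_coset xw; apply/mem_coset.
  by rewrite -(subrKA u); exact: lineD.
rewrite -(subrKA v); apply: lineD => //.
by rewrite -opprB -scaleN1r; exact: lineZ.
Qed.

(** The action descends to the quotient because the line is a submodule: changing [v] by an element
    of the line changes [act v a] by another one. *)
Lemma coset_actE x v a :
  coset_act (line x) (coset (line x) v) a = coset (line x) (act v a).
Proof.
apply/seteqP; split=> [w [u /mem_coset xu] /mem_coset xw|w xw].
  apply/mem_coset; rewrite -(subrKA (act u a)); apply: lineD => //.
  rewrite -[_ - _](_ : act (u - v) a = _); first exact: line_act_closed.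
  by rewrite actDl -scaleN1r actZl scaleN1r.
by exists v => //; apply/mem_coset; rewrite subrr -(act0 x); exists 0.
Qed.

Lemma coset_scaleE x (r : R) v :
  coset_scale (line x) r (coset (line x) v) = coset (line x) (r *: v).
Proof.
apply/seteqP; split=> [w [u /mem_coset xu] /mem_coset xw|w xw].
  apply/mem_coset; rewrite -(subrKA (r *: u)); apply: lineD => //.
  by rewrite -scalerBr; exact: lineZ.
by exists v => //; apply/mem_coset; rewrite subrr -(act0 x); exists 0.
Qed.

Lemma bracket_act x v a : regular x ->
  bracket (line x) x (coset (line x) v) (act x a) = coset (line x) (act v a).
Proof.
move=> rx; rewrite -coset_actE; apply/seteqP; split=> [w [b /= xb xw]|w xw].
  suff -> : a = b by [].
  apply/eqP; rewrite -subr_eq0; apply/eqP/(regular_act_inj rx).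
  by rewrite actB xb subrr.
by exists a.
Qed.

Lemma is_hom_bracket x v : regular x ->
  is_hom (line x) (bracket (line x) x (coset (line x) v)).
Proof.
move=> rx; split=> [_ [a _ <-]|_ _ w w' a [b _ <-] [b' _ <-]].
  by exists (act v a); rewrite bracket_act.
rewrite act_act -actD !bracket_act // actD -act_act.
(* [w] and [w'] are arbitrary representatives; they differ from [act v b] and [act v b'] by elements
   of the line. *)
move=> /cosetP xw /cosetP xw'; apply/cosetP.
rewrite opprD addrACA; apply: lineD => //.
rewrite -[_ - _](_ : act (act v b' - w') a = _); first exact: line_act_closed.
by rewrite actDl -scaleN1r actZl scaleN1r.
Qed.

(** By [A]-linearity, [L(x) a = L(x a)], so the bracket no longer refers to the chosen generator. *)
Lemma proj_restr_bracket x (r : R) L : regular x -> A_linear L ->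
  eq_hom (line x) (bracket (line x) x (coset (line x) (r *: L x)))
    (scale_hom (line x) r (proj_restr (line x) L)).
Proof.
move=> rx AL _ [a _ <-]; rewrite bracket_act // actZl.
by rewrite /scale_hom /proj_restr coset_scaleE AL.
Qed.

Lemma regular_iso g x : A_linear g -> lker g == 0%VS -> regular x -> regular (g x).
Proof.
move=> Ag kg [y [k k1 k2]]; exists (g y), (k \o g^-1%VF) => [p|u] /=.
  by rewrite -!Ag -linearD lker0_lfunK // k1.
by have /= E := k2 (g^-1%VF u); rewrite -!Ag -linearD E; exact: lker0_lfunVK.
Qed.

(** The relation [K g = g J] carries eigenvectors of [J] to eigenvectors of [K] with the same
    eigenvalue; invertibility of [g] preserves regularity. *)
Lemma is_eigenline_intertwine (s : bool) g J (K : 'End((A * A)%type)) x :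
  A_linear g -> lker g == 0%VS -> (forall u, K (g u) = g (J u)) ->
  regular x -> is_eigenline s J (line x) -> is_eigenline s K (line (g x)).
Proof.
move=> Ag kg KgJ rx [_ Jx]; split; first by exists (g x) => //; exact: regular_iso.
by move=> _ [a _ <-]; rewrite -Ag KgJ Jx ?linearZ //; exact: line_act.
Qed.

(** For fixed [x] and [a], both sides of the [A]-linearity equation are linear in the operator, so
    the equation along the curve can be differentiated. *)
Lemma A_linear_derivative (c : R -> 'End((A * A)%type)) t L :
  (\forall s \near t, A_linear (c s)) -> has_curve_derivative c t L -> A_linear L.
Proof.
move=> Ac dc x a.
have d1 : has_curve_derivative (fun s => c s (act x a)) t (L (act x a)).
  apply: (has_curve_derivative_linear
    (g := fun X : 'End((A * A)%type) => X (act x a)) _ dc) => r X Y.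
  by rewrite add_lfunE scale_lfunE.
have d2 : has_curve_derivative (fun s => act (c s x) a) t (act (L x) a).
  apply: (has_curve_derivative_linear
    (g := fun X : 'End((A * A)%type) => act (X x) a) _ dc) => r X Y.
  by rewrite add_lfunE scale_lfunE actDl actZl.
apply: has_curve_derivative_near_unique d1 d2.
by near=> s; have -> : A_linear (c s) by near: s.
Unshelve. all: by end_near. Qed.

End Lines.

(** * The form [h], eigenlines of operators in [CG], and their lifts along curves *)

Section Forms.
Variables (R : realType) (A : falgType R) (sigma : {linear A -> A}).
Hypothesis sigma_inv : anti_involution sigma.
Implicit Types (x y u : (A * A)%type) (J L : 'End((A * A)%type)).

Lemma h_nondegenerate u : (forall z, h sigma z u = 0) -> u = 0.
Proof.
have [sM sK] := sigma_inv.
have s1 : sigma (sigma 1) = 1 by rewrite sK.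
(* Pairing with [(0, sigma 1)] and [(sigma 1, 0)] extracts [p] and [q], since [h] applies [sigma] to
   its first argument and [sigma (sigma 1) = 1]. *)
case: u => p q hu; have := hu (0, sigma 1); have := hu (sigma 1, 0).
by rewrite /h /= !s1 !linear0 !mul0r !mul1r addr0 add0r => -> ->.
Qed.

(* [h_J] symmetric means [J] is [h]-self-adjoint, so its eigenlines are
   [h]-orthogonal; a zero divisor [a] of [h x x] then gives [x a] in the
   radical of [h]. *)
Lemma eigenline_PG (s : bool) J l :
  CG sigma J -> is_eigenline s J l -> PG sigma s l.
Proof.
move=> [[_ _ [lp ep] [lm em]] [_ _ bA bS bP]] [[x rx ->] Jx].
have [m [[y ry my] Jy]] : exists m, is_eigenline (~~ s) J m.
  by case: (s); [exists lp|exists lm].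
rewrite my in Jy; exists x; split=> //.
have Jxx : J x = (-1) ^+ s *: x by apply: Jx; exact: line_self.
have Jyy : J y = (-1) ^+ (~~ s) *: y by apply: Jy; exact: line_self.
have [sM sK] := sigma_inv.
have hZ (r : R) u v : h sigma (r *: u) v = r *: h sigma u v.
  by rewrite /h /= !linearZ /= -!scalerAl scalerDr.
have hS u v : h sigma u v = sigma (h sigma v u).
  by rewrite /h linearD /= !sM !sK addrC.
have hA u v a : h sigma u (act v a) = h sigma u v * a.
  by rewrite /h /= !mulrA mulrDl.
have yx0 : h sigma y x = 0.
  have := bS y x; rewrite /= Jxx Jyy !hZ linearZ /= -hS.
  have neg (w : A) : w = - w -> w = 0.
    move=> /eqP; rewrite -subr_eq0 opprK -mulr2n -scaler_nat scaler_eq0.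
    by rewrite pnatr_eq0 => /eqP.
  case: (s); rewrite /= !(expr0, expr1) scale1r scaleN1r; first exact: neg.
  by move=> /esym; exact: neg.
(* Positivity of [h_J] at [x] gives [h (J x) x = c ^+ 2] with [c] symmetric, so [h x x] is this
   square up to the sign; what remains is that [c] is a unit. *)
have [[c sc hc] _] := bP x rx.
rewrite /= Jxx hZ in hc.
have hcx : h sigma x x = (-1) ^+ s *: c ^+ 2.
  by rewrite hc scalerA -expr2 sqrr_sign scale1r.
exists c.
  split=> //=; apply: unit_mul_inj => a ca0.
  apply: (regular_act_inj rx); apply: h_nondegenerate => z.
  have [p [q ->]] := eigenline_decomp rx (conj (ex_intro2 _ _ x rx erefl) Jx)
    ry (conj (ex_intro2 _ _ y ry erefl) Jy) z.
  have hD : h sigma (act x p + act y q) x =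
      sigma p * h sigma x x + sigma q * h sigma y x.
    by rewrite /h /= !linearD /= !sM !mulrDl !mulrDr !mulrA addrACA.
  by rewrite hA hD yx0 mulr0 addr0 hcx -scalerAr -scalerAl -!mulrA ca0 !mulr0 scaler0.
by rewrite hcx; case: (s); rewrite !(expr0, expr1) ?scale1r ?mul1r ?scaleN1r ?mulN1r.
Qed.

(* For [c t] near [J], [Phi t = (1 + c t J) / 2] is near the identity and
   [c t \o Phi t = Phi t \o J], since [J] and [c t] are involutions; hence
   [Phi t] maps each eigenline of [J] onto that of [c t]. *)
Lemma CG_curve_lift (s : bool) (c : R -> 'End((A * A)%type)) J L x :
  CG sigma J -> regular x -> is_eigenline s J (line x) ->
  curve_through (CG sigma) c J L ->
  let y t := 2^-1 *: x + ((-1) ^+ s / 2) *: c t x in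
  [/\ \forall t \near 0, regular (y t) /\ is_eigenline s (c t) (line (y t)),
      y 0 = x & has_curve_derivative y 0 (((-1) ^+ s / 2) *: L x)].
Proof.
move=> [[AJ JJ _ _] _] rx ex [Cc c0 dc] y.
have half (u : (A * A)%type) : 2^-1 *: u + 2^-1 *: u = u.
  by rewrite -scalerDl -mulr2n -[_^-1 *+ 2]mulr_natr mulVf ?pnatr_eq0 // scale1r.
have invol (K : 'End((A * A)%type)) u : (K \o K = \1)%VF -> K (K u) = u.
  by move=> /lfunP /(_ u); rewrite comp_lfunE id_lfunE.
have Jx : J x = (-1) ^+ s *: x.
  by case: ex => _; apply; exact: line_self.
pose Phi t : 'End((A * A)%type) := 2^-1 *: \1%VF + 2^-1 *: (c t \o J)%VF.
have PhiE t u : Phi t u = 2^-1 *: u + 2^-1 *: c t (J u).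
  by rewrite add_lfunE !scale_lfunE comp_lfunE id_lfunE.
have yE t : y t = Phi t x by rewrite PhiE Jx linearZ scalerA mulrC.
have Phi0 : Phi 0 = \1%VF.
  by apply/lfunP => u; rewrite PhiE c0 invol // half id_lfunE.
(* Differentiability of [Phi] at 0 lets invertibility spread from [Phi 0 = 1] to nearby times. *)
have dPhi : has_curve_derivative Phi 0 (2^-1 *: (L \o J)%VF).
  apply: (has_curve_derivative_affine
    (g := fun X : 'End((A * A)%type) => 2^-1 *: (X \o J)%VF) _ _ dc) => r X Y.
  by rewrite comp_lfunDl -comp_lfunZl scalerDr !scalerA mulrC.
split; last 2 first.
- by rewrite yE Phi0 id_lfunE.
- apply: (has_curve_derivative_affine
    (g := fun X : 'End((A * A)%type) => ((-1) ^+ s / 2) *: X x) _ _ dc) => r X Y.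
  by rewrite add_lfunE scale_lfunE scalerDr !scalerA mulrC.
have kPhi : \forall t \near (0 : R), lker (Phi t) == 0%VS.
  apply: near_lker0 dPhi _.
  by rewrite Phi0; apply/lker0P => u v; rewrite !id_lfunE.
near=> t; rewrite yE.
have kt : lker (Phi t) == 0%VS by near: t.
have [[Act cct _ _] _] : CG sigma (c t) by near: t.
have APhi : A_linear (Phi t).
  by move=> u a; rewrite !PhiE AJ Act actDl !actZl.
split; first exact: regular_iso.
apply: is_eigenline_intertwine APhi kt _ rx ex => u.
(* Both sides equal half of [c t u + J u]. *)
by rewrite !PhiE linearD !linearZ /= !invol // addrC.
Unshelve. all: by end_near. Qed.

End Forms.

(** * The eigenline map and its differential *)

Theorem proposition3p4 (R : realType) (A : falgType R) (sigma : {linear A -> A})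
    (A_semisimple : semisimple_algebra A)
    (sigma_inv : anti_involution sigma) (A_hermitian : is_hermitian sigma)
    (s : bool) :
  (forall J, CG sigma J ->
     is_eigenline s J (eigenline s J) /\ PG sigma s (eigenline s J)) /\
  (forall (J L : 'End((A * A)%type)) (x : A * A),
     CG sigma J -> tangent (CG sigma) J L -> generator x (eigenline s J) ->
     let l := eigenline s J in
     let w := coset l (((-1) ^+ s / 2) *: L x) in
     [/\ is_differential (CG sigma) (PG sigma s) (eigenline s) J L
           (bracket l x w),
         eq_hom l (bracket l x w) (scale_hom l ((-1) ^+ s / 2) (proj_restr l L))
       & is_hom l (bracket l x w)]).
Proof.
have eig J : CG sigma J -> is_eigenline s J (eigenline s J).
  move=> CJ; have [l el] : exists l, is_eigenline s J l.
    by case: CJ => -[_ _ [lp ep] [lm em]] _; case: (s); [exists lm|exists lp].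
  by rewrite (CG_eigenline CJ el).
have eigP J : CG sigma J -> PG sigma s (eigenline s J).
  by move=> CJ; exact: (eigenline_PG sigma_inv CJ (eig J CJ)).
split=> [J CJ|J L x CJ tL xl /=]; first by split; [exact: eig|exact: eigP].
have eJ := eig J CJ.
have rx : regular x by case: eJ => lJ _; exact: regular_generator lJ xl.
(* A tangent vector is a velocity of a curve of [A]-linear operators. *)
have AL : A_linear L.
  have [c [Cc _ dc]] := tL.
  by apply: A_linear_derivative dc; apply: filterS Cc => t [[]].
rewrite xl in eJ *; split.
- move=> c cJ; have [yl y0 dy] := CG_curve_lift CJ rx eJ cJ.
  have [Cc c0 _] := cJ.
  (* The lift starts at [x] with velocity the representative of [w], so the required bracket is
     literally the given one. *)
  exists (fun t => 2^-1 *: x + ((-1) ^+ s / 2) *: c t x), (((-1) ^+ s / 2) *: L x).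
  split=> //; last by rewrite y0 /= c0 xl.
  near=> t.
  have Ct : CG sigma (c t) by near: t.
  have [ry ey] : regular (2^-1 *: x + ((-1) ^+ s / 2) *: c t x) /\
      is_eigenline s (c t) (line (2^-1 *: x + ((-1) ^+ s / 2) *: c t x)).
    by near: t.
  (* Uniqueness of eigenlines identifies [eigenline s (c t)] with the line spanned by the lift. *)
  by split=> //=; [exact: eigP|exact: CG_eigenline Ct ey].
- exact: proj_restr_bracket.
- exact: is_hom_bracket.
Unshelve. all: by end_near. Qed.
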